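(* There exists a $3$-edge-connected digraph $D=(V,A)$ with $|V|=122$ such that for every even subgraph $E\subseteq A$ the digraph $D/E$ is not strongly connected.
   Context: A digraph $D=(V,A)$ is $3$-edge-connected if its underlying undirected graph is. An even subgraph of $D$ is a subset $E\subseteq A$ that is an edge-disjoint union of cycles of the underlying undirected graph (the cycles are not necessarily directed; $E$ may be empty); equivalently, every vertex is incident with an even number of arcs of $E$. For $E\subseteq A$, $D/E$ denotes the digraph obtained from $D$ by contracting all arcs of $E$. (The proposition says that there is a counterexample on $122$ vertices to Hochstättler's conjecture, which asserts that every $3$-edge-connected digraph $D$ has an even subgraph $E$ such that $D/E$ is strongly connected.) *)

(* Defs.v *)
From mathcomp Require Import all_boot.

Set Implicit Arguments.
Unset Strict Implicit.
Unset Printing Implicit Defensive.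

(* Contracting arcs can create loops and parallel arcs, so arcs form a type of
   their own, with end maps; see [is_digraph] for the case A \subset V * V. *)
Record multidigraph := Multidigraph {
  vertex : finType;
  arcs : finType;
  source : arcs -> vertex;
  target : arcs -> vertex }.

(* Arcs are ordered pairs of distinct vertices.  A pair of opposite arcs is
   allowed, and counts as two edges of the underlying undirected graph. *)
Definition is_digraph (D : multidigraph) : Prop :=
  (forall a : arcs D, source a != target a) /\
  injective (fun a : arcs D => (source a, target a)).

Definition joins (D : multidigraph) (a : arcs D) (x y : vertex D) : bool :=
  ((source a == x) && (target a == y)) || ((source a == y) && (target a == x)).

Definition adjacent (D : multidigraph) (S : {set arcs D}) : rel (vertex D) :=
  [rel x y | [exists a in S, joins a x y]].

Definition edge_connected (k : nat) (D : multidigraph) : Prop :=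
  1 < #|vertex D| /\
  forall F : {set arcs D}, #|F| < k ->
    forall x y : vertex D, connect (adjacent (~: F)) x y.

(* Cycle v_0 a_0 v_1 a_1 ... v_n a_n v_0 of the underlying undirected graph,
   the index successor [ordS] being cyclic.  Length 1 is a loop, length 2 a pair
   of parallel or opposite arcs; injectivity of [a] matters only for length 2. *)
Definition is_cycle (D : multidigraph) (C : {set arcs D}) : Prop :=
  exists (n : nat) (v : 'I_n.+1 -> vertex D) (a : 'I_n.+1 -> arcs D),
    [/\ injective v, injective a,
        forall i : 'I_n.+1, joins (a i) (v i) (v (ordS i)) &
        C = [set a i | i : 'I_n.+1]].

Definition even_subgraph (D : multidigraph) (E : {set arcs D}) : Prop :=
  exists P : {set {set arcs D}},
    partition P E /\ forall C : {set arcs D}, C \in P -> is_cycle C.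

Definition component (D : multidigraph) (E : {set arcs D}) (x : vertex D) :
    {set vertex D} :=
  [set y | connect (adjacent E) x y].

Definition contract_vertex (D : multidigraph) (E : {set arcs D}) : finType :=
  {B : {set vertex D} | B \in [set component E x | x : vertex D]}.

Definition contract_arc (D : multidigraph) (E : {set arcs D}) : finType :=
  {a : arcs D | a \notin E}.

Definition to_contract (D : multidigraph) (E : {set arcs D}) (x : vertex D) :
    contract_vertex E :=
  exist _ (component E x) (imset_f (component E) (isT : x \in vertex D)).

Definition contract (D : multidigraph) (E : {set arcs D}) : multidigraph :=
  {| vertex := contract_vertex E;
     arcs := contract_arc E;
     source := fun a => to_contract E (source (val a));
     target := fun a => to_contract E (target (val a)) |}.

Definition strongly_connected (D : multidigraph) : Prop :=
  forall x y : vertex D,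
    connect [rel u w | [exists a : arcs D, (source a == u) && (target a == w)]] x y.

(* Main.v *)
Require Import Defs.
From mathcomp Require Import all_boot.

(** If D/E is strongly connected, then E meets every directed cut of D.

    Orient the Petersen graph so that the two perfect matchings containing some
    edge e = sr are directed cuts, s is a source and r a sink, and let E be an
    even subgraph meeting every directed cut and visiting the four vertices
    outside N[r] and N[s].  If E avoided e, it would contain the other two
    edges at s and at r, hence visit all ten vertices, and so be the complement
    of a perfect matching through e: but these are directed cuts.

    The four visits are forced by replacing each of the four vertices by a
    K_{2,3} in which the three vertices that carry the former edges are
    sources or sinks, hence visited by E: if E contained none of the former
    edges, then the other two vertices would have degree 3 in E.

    Removing r leaves a fragment on 5 + 4 * 5 vertices with three dangling arcs,
    one of which, e, lies in every such E.  Three fragments whose arcs e end in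
    a common vertex v of degree 3 contradict the parity of E at v.  Their other
    dangling arcs end in a complete digraph on 122 - 3 * 25 - 1 = 46 vertices,
    which no directed cut separates. *)

Set Implicit Arguments.
Unset Strict Implicit.
Unset Printing Implicit Defensive.

(** * Cuts, contraction and linkage in arbitrary multidigraphs *)

Section Multidigraph.
Variable D : multidigraph.
Implicit Types (E F P : {set arcs D}) (X : {set vertex D}) (x y z : vertex D).

Definition crosses X (a : arcs D) : bool :=
  (source a \in X) (+) (target a \in X).

Lemma joins_crosses X (a : arcs D) x y :
  joins a x y -> crosses X a = (x \in X) (+) (y \in X).
Proof.
by rewrite /crosses => /orP[] /andP[/eqP-> /eqP->] //; rewrite addbC.
Qed.

(** Each vertex of the cycle counts once as [v i] and once as [v (ordS i)], so its membership bit
    cancels after a cyclic reindexing. *)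
Lemma cycle_cut_even (C : {set arcs D}) X :
  is_cycle C -> \big[addb/false]_(a in C) crosses X a = false.
Proof.
case=> n [v] [a] [_ a_inj a_joins ->].
rewrite big_imset /=; last by move=> i j _ _; apply: a_inj.
under eq_bigr => i _ do rewrite (joins_crosses X (a_joins i)).
rewrite big_split /= [X in X (+) _](reindex_inj (@ordS_inj _)) /=.
by rewrite addbb.
Qed.

Lemma even_cut E X :
  even_subgraph E -> \big[addb/false]_(a in E) crosses X a = false.
Proof.
case=> P [/and3P[/eqP <- trP _] cycP]; rewrite big_trivIset //=.
by apply: big1 => C /cycP; apply: cycle_cut_even.
Qed.

Lemma adjacent_sym E : symmetric (adjacent E).
Proof.
move=> x y; apply/existsP/existsP => -[a /andP[aE axy]]; exists a;
  by rewrite aE /joins orbC.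
Qed.

(** If no arc of [E] crossed [X], then [X] would be a union of components of [E]. Since no arc
    enters [X], no path of the contraction could then lead from the component of [y] to that of
    [x]. *)
Lemma strongly_connected_dicut E X x y :
  strongly_connected (contract E) -> x \in X -> y \notin X ->
  (forall a : arcs D, target a \in X -> source a \in X) ->
  exists2 a, a \in E & crosses X a.
Proof.
move=> sc xX yX outX; apply/exists_inP; apply: contraT => /exists_inPn noE.
have clX : closed (adjacent E) (mem X).
  move=> u w /existsP[a /andP[/noE + auw]].
  by rewrite (joins_crosses X auw) negb_add => /eqP.
(* The invariant along paths of the contraction: the current component lies outside [X]. *)
pose Q (B : contract_vertex E) := [disjoint val B & X].
have Qto u : Q (to_contract E u) = (u \notin X).
  apply/pred0P/idP => [/(_ u)|uX w] /=; first by rewrite inE connect0 /= => ->.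
  by rewrite inE; apply/negP => /andP[/(closed_connect clX) <-]; apply/negP.
have clQ (B C : contract_vertex E) :
    connect [rel u w | [exists a : arcs (contract E),
                          (source a == u) && (target a == w)]] B C ->
    Q B -> Q C.
  case/connectP=> p + ->; elim: p B => //= B' p IHp B /andP[/existsP[a]].
  case/andP=> /eqP <- /eqP <- /IHp{}IHp Qa; apply: IHp.
  by move: Qa; rewrite !Qto; apply: contra; apply: outX.
have := clQ _ _ (sc (to_contract E y) (to_contract E x)).
by rewrite !Qto yX xX => /(_ isT).
Qed.

Lemma strongly_connected_cut E X x y :
  strongly_connected (contract E) -> x \in X -> y \notin X ->
  (forall a : arcs D, target a \in X -> source a \in X) \/
  (forall a : arcs D, source a \in X -> target a \in X) ->
  exists2 a, a \in E & crosses X a.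
Proof.
move=> sc xX yX [] dX; first exact: strongly_connected_dicut xX yX dX.
have [||a|a aE] := @strongly_connected_dicut E (~: X) y x sc.
- by rewrite inE.
- by rewrite inE xX.
- by rewrite !inE; apply/contra/dX.
by rewrite /crosses !inE addNb addbN negbK; exists a.
Qed.

(** A pairwise form of 3-edge-connectivity. Being an equivalence relation, it only has to be checked
    against one base vertex. *)
Definition linked x y : Prop :=
  forall F, #|F| < 3 -> connect (adjacent (~: F)) x y.

Lemma linked_refl x : linked x x.
Proof. by move=> F _; apply: connect0. Qed.

Lemma linked_sym x y : linked x y -> linked y x.
Proof.
by move=> xy F F3; rewrite (sym_connect_sym (adjacent_sym _)); apply: xy.
Qed.

Lemma linked_trans y x z : linked x y -> linked y z -> linked x z.
Proof. by move=> xy yz F F3; apply: connect_trans (xy F F3) (yz F F3). Qed.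

(** Pigeonhole: fewer than three arcs cannot meet all three disjoint sets [P k], so some [P k]
    survives and leads from [x] to [z k]. *)
Lemma linked_fan x y (P : 'I_3 -> {set arcs D}) (z : 'I_3 -> vertex D) :
  (forall k l, k != l -> [disjoint P k & P l]) ->
  (forall k F, [disjoint P k & F] -> connect (adjacent (~: F)) x (z k)) ->
  (forall k, linked (z k) y) -> linked x y.
Proof.
move=> disjP Pxz zy F F3.
have [/existsP[k /Pxz xzk]|] := boolP [exists k, [disjoint P k & F]].
  exact: connect_trans xzk (zy k F F3).
rewrite negb_exists => /forallP meetP.
have meet k : exists a, a \in P k :&: F by apply/set0Pn; rewrite setI_eq0.
have [f Pf] := fin_all_exists meet.
suff f_inj : injective f.
  suff : 3 <= #|F| by rewrite leqNgt F3.
  rewrite -[3]card_ord -(card_codom f_inj); apply/subset_leq_card/subsetP => a.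
  by case/codomP=> k ->; case/setIP: (Pf k).
move=> k l fkl; apply: contraTeq isT => /disjP /disjoint_setI0 /setP/(_ (f k)).
rewrite !inE; case/setIP: (Pf k) => -> _; rewrite fkl.
by case/setIP: (Pf l) => ->.
Qed.

Lemma connect_arc (a : arcs D) F :
  a \notin F -> connect (adjacent (~: F)) (source a) (target a).
Proof.
by move=> aF; apply/connect1/existsP; exists a; rewrite inE aF /joins !eqxx.
Qed.

Lemma connect_arc_rev (a : arcs D) F :
  a \notin F -> connect (adjacent (~: F)) (target a) (source a).
Proof.
by rewrite (sym_connect_sym (adjacent_sym _)); apply: connect_arc.
Qed.

End Multidigraph.

(** * The fragment *)

(* Vertices 0, 1 and 2 = s are the neighbours of r, and 3, 4 those of s.  The
   blocks 5-9, 10-14, 15-19 and 20-24 are the copies of K_{2,3}.  Arc 0 is e;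
   its end is 25, which stands for v, and 26 stands for the complete digraph. *)
Definition fragment : seq (nat * nat) :=
  [:: (2, 25); (1, 26); (0, 26); (2, 3); (2, 4); (15, 0); (5, 0); (3, 7);
      (3, 21); (10, 6); (11, 1); (4, 16); (20, 1); (4, 12); (17, 22);
      (5, 8); (5, 9); (8, 6); (9, 6); (8, 7); (9, 7);
      (10, 13); (10, 14); (11, 13); (11, 14); (13, 12); (14, 12);
      (15, 18); (15, 19); (18, 16); (19, 16); (17, 18); (17, 19);
      (20, 23); (20, 24); (23, 21); (24, 21); (23, 22); (24, 22)].

Definition frag_source (j : nat) : nat := (nth (0, 0) fragment j).1.
Definition frag_target (j : nat) : nat := (nth (0, 0) fragment j).2.

Definition frag_cut (X : seq nat) : seq nat :=
  [seq j <- iota 0 39 | (frag_source j \in X) (+) (frag_target j \in X)].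

Definition directed (X s : seq nat) : bool :=
  all (fun j => frag_source j \in X) s || all (fun j => frag_target j \in X) s.

Lemma directedP (X s : seq nat) : directed X s ->
  {in s, forall j, frag_source j \in X} \/
  {in s, forall j, frag_target j \in X}.
Proof. by case/orP => /allP; [left | right]. Qed.

(* The first two cuts are the perfect matchings through e, the third is the
   star of r. *)
Definition frag_sets : seq (seq nat) :=
  [:: [:: 2; 3; 4] ++ iota 5 10, [:: 2; 3; 4] ++ iota 15 10, iota 0 25
    & [seq [:: x] | x <- iota 0 25]].

(** A constraint is the arc list of a cut with a flag for directed cuts: the parity test applies to
    every cut, the hitting test only to directed ones. *)
Definition violated (e : nat -> bool) (c : seq nat * bool) : bool :=
  odd (count e c.1) || c.2 && ~~ has e c.1.

(* Exhaustive search over the even subgraphs of the fragment: [w] says which of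
   the first arcs are taken.  Boolean connectives would be evaluated eagerly by
   [vm_compute]; the nested [if] prune the search. *)
Fixpoint refuted (cs : seq (seq nat * bool)) (n : nat) (w : seq bool) : bool :=
  if has (fun c => all (fun j => j < size w) c.1 && violated (nth false w) c) cs
  then true
  else if n is n'.+1 then
    if refuted cs n' (rcons w false) then refuted cs n' (rcons w true)
    else false
  else false.

(** A solution [e] is itself a branch of the search that is never pruned. A constraint is tested
    only once all its arcs are decided, so the default value of [nth] is never read. *)
Lemma refutedP cs n k (e : nat -> bool) :
  (forall c, c \in cs -> ~~ violated e c) -> refuted cs n (mkseq e k) = false.
Proof.
move=> sat.
have sat_prefix k' : has (fun c => all (fun j => j < size (mkseq e k')) c.1 &&
    violated (nth false (mkseq e k')) c) cs = false.
  apply/hasPn => c /sat /negbTE ok; rewrite size_mkseq negb_and.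
  apply/orP; case: allP => [ltk|]; [right | by left].
  have eq_e : {in c.1, nth false (mkseq e k') =1 e}.
    by move=> j /ltk jk; rewrite nth_mkseq.
  by move: ok; rewrite /violated (eq_in_count eq_e) (eq_in_has eq_e) => ->.
elim: n k => [|n IHn] k /=; rewrite sat_prefix //.
have := IHn k.+1; rewrite mkseqS.
by case: (e k) => ->; rewrite ?if_same.
Qed.

Lemma fragment_arc0 (e : nat -> bool) :
  {in frag_sets, forall X,
    ~~ odd (count e (frag_cut X)) /\
    (directed X (frag_cut X) -> has e (frag_cut X))} -> e 0.
Proof.
move=> sat; apply: contraT => /negbTE e0.
set cs := [seq (frag_cut X, directed X (frag_cut X)) | X <- frag_sets].
(* Arc 0 is fixed as absent, which leaves 38 of the 39 arcs to decide. *)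
have : refuted cs 38 [:: false] = false.
  have -> : [:: false] = mkseq e 1 by rewrite /mkseq /= e0.
  apply: refutedP => c /mapP[X /sat[ev hit] ->].
  by rewrite /violated negb_or ev negb_and negbK /= -implybE; apply/implyP.
by vm_compute.
Qed.

(** * The counterexample *)

Definition vertices : finType := (('I_3 * 'I_25) + option 'I_46)%type.
Definition arrows : finType :=
  (('I_3 * 'I_39) + {p : 'I_46 * 'I_46 | p.1 != p.2})%type.

(* Places the vertices of the [i]-th fragment; [inr None] is v. *)
Definition glue (i : 'I_3) (x : nat) : vertices :=
  if insub x is Some y then inl (i, y)
  else inr (if x == 25 then None else Some ord0).

Definition counterexample : multidigraph :=
  {| vertex := vertices;
     arcs := arrows;
     source := fun a => match a with
       | inl (i, j) => glue i (frag_source j)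
       | inr p => inr (Some (val p).1) end;
     target := fun a => match a with
       | inl (i, j) => glue i (frag_target j)
       | inr p => inr (Some (val p).2) end |}.

Lemma card_counterexample : #|vertex counterexample| = 122.
Proof. by rewrite card_sum card_prod card_option !card_ord. Qed.

Definition local (u : vertices) : nat :=
  match u with inl (_, x) => x | inr None => 25 | inr (Some _) => 26 end.

Lemma localK i x : x < 27 -> local (glue i x) = x.
Proof.
rewrite /glue; case: insubP => [y _ <- //|].
by case: x => // x; do 26?[case: x => // x].
Qed.

Lemma glue_inj i i' x : x < 25 -> glue i x = glue i' x -> i = i'.
Proof. by move=> x25; rewrite /glue insubT => -[]. Qed.

Lemma fragment_bound (j : 'I_39) :
  [/\ frag_source j < 25, frag_target j < 27 & frag_source j != frag_target j].
Proof.
have : all (fun p : nat * nat => [&& p.1 < 25, p.2 < 27 & p.1 != p.2]) fragment.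
  by [].
by move/(all_nthP (0, 0))/(_ j (ltn_ord j))/and3P.
Qed.

Lemma counterexample_is_digraph : is_digraph counterexample.
Proof.
split=> [[[i j]|p] /=|].
- have [s25 t27 st] := fragment_bound j.
  apply: contraNneq st => /(congr1 local).
  by rewrite !localK ?(ltn_trans s25) // => ->.
- by rewrite (inj_eq inr_inj) (inj_eq Some_inj) (valP p).
- move=> [[i j]|p] [[i' j']|q] /= [].
  + have [s25 t27 _] := fragment_bound j.
    have [s25' t27' _] := fragment_bound j'.
    move=> es /(congr1 local) et; have := congr1 local es.
    rewrite !localK ?(ltn_trans s25) ?(ltn_trans s25') // in et * => es'.
    rewrite -es' in es; rewrite (glue_inj s25 es).
    suff /val_inj -> : j = j' :> nat by [].
    apply/eqP; rewrite -(@nth_uniq _ (0, 0) fragment) ?ltn_ord //.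
    by apply/eqP/injective_projections.
  + by have [s25 _ _] := fragment_bound j; rewrite /glue insubT.
  + by have [s25 _ _] := fragment_bound j'; rewrite /glue insubT.
  + by move=> [e1] [e2]; congr inr; apply/val_inj/injective_projections.
Qed.

(** * Cuts of the counterexample inside a single fragment *)

Definition part (i : 'I_3) (X : seq nat) : {set vertex counterexample} :=
  [set u | if u is inl (i', x) then (i' == i) && (val x \in X) else false].

Lemma mem_part i i' x (X : seq nat) :
  all (gtn 25) X -> (glue i' x \in part i X) = (i' == i) && (x \in X).
Proof.
move=> X25; rewrite inE /glue; case: insubP => [y _ <- //|x25].
have /negbTE -> : x \notin X by apply: contra x25 => /(allP X25).
by rewrite andbF.
Qed.

Lemma frag_sets_bound : {in frag_sets, forall X, all (gtn 25) X}.
Proof. by apply/allP. Qed.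

Lemma frag_sets_nonempty : {in frag_sets, forall X, exists x, x \in X}.
Proof.
have : [::] \notin frag_sets by [].
by move=> n0 [|x X] XS; [rewrite XS in n0 | exists x; apply: mem_head].
Qed.

Lemma odd_count_iota (e a : pred nat) n :
  odd (count e [seq j <- iota 0 n | a j]) =
    \big[addb/false]_(j < n | a j) e j.
Proof.
rewrite -(big_mkord a e) /index_iota subn0 -big_filter.
by elim: filter => [|x s IHs]; rewrite ?big_nil // big_cons /= oddD IHs oddb.
Qed.

Lemma big_arcs (f : arcs counterexample -> bool) :
  \big[addb/false]_a f a =
    (\big[addb/false]_i \big[addb/false]_j f (inl (i, j)))
    (+) \big[addb/false]_p f (inr p).
Proof.
rewrite big_sumType /= pair_bigA /=; congr (_ (+) _).
by apply: eq_bigr => -[].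
Qed.

Section Parts.
Variables (E : {set arcs counterexample}) (i : 'I_3) (X : seq nat).
Hypothesis X25 : all (gtn 25) X.

Let e (j : nat) : bool := inl (i, inord j) \in E.

Let e_ord (j : 'I_39) : e j = (inl (i, j) \in E).
Proof. by rewrite /e inord_val. Qed.

Lemma crosses_part_inl i' (j : 'I_39) : crosses (part i X) (inl (i', j)) =
  (i' == i) && ((frag_source j \in X) (+) (frag_target j \in X)).
Proof. by rewrite /crosses /= !mem_part //; case: (i' == i). Qed.

Lemma crosses_part_inr p : crosses (part i X) (inr p) = false.
Proof. by rewrite /crosses /= !inE. Qed.

(** The arcs crossing [part i X] are exactly the copies, in fragment [i], of the arcs in
    [frag_cut X]. *)
Lemma frag_cut_even : even_subgraph E -> ~~ odd (count e (frag_cut X)).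
Proof.
move=> evenE.
apply/negbT; rewrite -[RHS](even_cut (part i X) evenE) odd_count_iota.
rewrite [RHS]big_mkcond big_arcs.
rewrite [X in _ (+) X]big1 ?addbF => [|p _]; last first.
  by rewrite crosses_part_inr if_same.
rewrite (bigD1 i) //= [X in _ (+) X]big1 ?addbF => [|i' /negbTE i'i].
  rewrite [LHS]big_mkcond; apply: eq_bigr => j _.
  by rewrite crosses_part_inl eqxx e_ord; case: (_ (+) _); case: (_ \in E).
by apply: big1 => j _; rewrite crosses_part_inl i'i if_same.
Qed.

Lemma mem_frag_cut (j : 'I_39) :
  ((j : nat) \in frag_cut X) = (frag_source j \in X) (+) (frag_target j \in X).
Proof. by rewrite mem_filter mem_iota leq0n ltn_ord !andbT. Qed.

Lemma part_dicut : directed X (frag_cut X) ->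
  (forall a : arcs counterexample,
     target a \in part i X -> source a \in part i X) \/
  (forall a : arcs counterexample,
     source a \in part i X -> target a \in part i X).
Proof.
case/directedP => dX; [left | right] => -[[i' j]|p] /=;
  rewrite ?(mem_part _ _ _ X25) ?[inr _ \in _]inE // => /andP[-> jX] /=;
  move: (dX j); rewrite mem_frag_cut jX ?addbT.
  by case: (frag_source j \in X) => // /(_ isT).
by case: (frag_target j \in X) => // /(_ isT).
Qed.

Lemma frag_dicut_hit x :
  strongly_connected (contract E) -> x \in X -> directed X (frag_cut X) ->
  has e (frag_cut X).
Proof.
move=> scE xX dX.
have [||a aE] := @strongly_connected_cut counterexample E (part i X)
                    (glue i x) (inr None) scE _ _ (part_dicut dX).
- by rewrite mem_part ?eqxx.
- by rewrite inE.
case: a aE => [[i' j]|p]; last by rewrite crosses_part_inr.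
rewrite crosses_part_inl => jE /andP[/eqP def_i' jX].
apply/hasP; exists (j : nat).
  by rewrite mem_frag_cut.
by rewrite e_ord -def_i'.
Qed.

End Parts.

Lemma arc0_in_dijoin (E : {set arcs counterexample}) (i : 'I_3) :
  even_subgraph E -> strongly_connected (contract E) -> inl (i, ord0) \in E.
Proof.
move=> evenE scE.
have -> : ord0 = inord 0 :> 'I_39 by apply/val_inj; rewrite /= inordK.
apply: (@fragment_arc0 (fun j => inl (i, inord j) \in E)) => X XS.
have [x xX] := frag_sets_nonempty XS; have X25 := frag_sets_bound XS.
by split; [apply: frag_cut_even | apply: frag_dicut_hit xX].
Qed.

(** * Edge connectivity *)

(* Arcs not incident with [x] do not move it, which is harmless: [walk x p] is
   connected to [x] in any case. *)
Definition move (x j : nat) : nat :=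
  if frag_source j == x then frag_target j
  else if frag_target j == x then frag_source j else x.

Definition walk : nat -> seq nat -> nat := foldl move.

(* Each [(x, ps)] gives three arc-disjoint walks from [x] to vertices already
   known to be linked. *)
Fixpoint fans_ok (S : seq nat) (fans : seq (nat * seq (seq nat))) : bool :=
  if fans is (x, ps) :: fans' then
    [&& uniq (flatten ps), all (gtn 39) (flatten ps), size ps == 3,
        all (fun p => walk x p \in S) ps & fans_ok (x :: S) fans']
  else true.

(** The order matters: starting from 25 and 26, every walk ends at one of these two or at a vertex
    listed earlier. *)
Definition fans : seq (nat * seq (seq nat)) :=
  [:: (3, [:: [:: 3; 0]; [:: 7; 19; 15; 6; 2]; [:: 8; 35; 33; 12; 1]]);
      (2, [:: [:: 0]; [:: 3]; [:: 4; 13; 25; 23; 10; 1]]);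
      (0, [:: [:: 2]; [:: 5; 27; 29; 11; 4]; [:: 6; 15; 19; 7]]);
      (1, [:: [:: 1]; [:: 10; 23; 25; 13; 4]; [:: 12; 33; 35; 8]]);
      (4, [:: [:: 4]; [:: 11; 29; 27; 5]; [:: 13; 25; 23; 10]]);
      (8, [:: [:: 15; 6]; [:: 17; 9; 21; 23; 10]; [:: 19; 7]]);
      (5, [:: [:: 6]; [:: 15]; [:: 16; 20; 7]]);
      (7, [:: [:: 7]; [:: 19]; [:: 20; 16]]);
      (9, [:: [:: 16]; [:: 18; 17]; [:: 20]]);
      (6, [:: [:: 9; 21; 23; 10]; [:: 17]; [:: 18]]);
      (13, [:: [:: 21; 9]; [:: 23; 10]; [:: 25; 13]]);
      (10, [:: [:: 9]; [:: 21]; [:: 22; 24; 10]]);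
      (11, [:: [:: 10]; [:: 23]; [:: 24; 22]]);
      (12, [:: [:: 13]; [:: 25]; [:: 26; 22]]);
      (14, [:: [:: 22]; [:: 24]; [:: 26]]);
      (18, [:: [:: 27; 5]; [:: 29; 11]; [:: 31; 14; 37; 33; 12]]);
      (15, [:: [:: 5]; [:: 27]; [:: 28; 30; 11]]);
      (16, [:: [:: 11]; [:: 29]; [:: 30; 28]]);
      (19, [:: [:: 28]; [:: 30]; [:: 32; 31]]);
      (17, [:: [:: 14; 37; 33; 12]; [:: 31]; [:: 32]]);
      (23, [:: [:: 33; 12]; [:: 35; 8]; [:: 37; 14]]);
      (20, [:: [:: 12]; [:: 33]; [:: 34; 36; 8]]);
      (21, [:: [:: 8]; [:: 35]; [:: 36; 34]]);
      (22, [:: [:: 14]; [:: 37]; [:: 38; 34]]);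
      (24, [:: [:: 34]; [:: 36]; [:: 38]])].

Definition path_arcs (i : 'I_3) (p : seq nat) : {set arcs counterexample} :=
  [set a : arcs counterexample |
     if a is inl (i', j) then (i' == i) && (val j \in p) else false].

Lemma connect_walk i x (p : seq nat) (F : {set arcs counterexample}) :
  all (gtn 39) p -> [disjoint path_arcs i p & F] ->
  connect (adjacent (~: F)) (glue i x) (glue i (walk x p)).
Proof.
move=> p39 dpF.
have: forall j, j \in p -> exists2 k : 'I_39, j = k & inl (i, k) \notin F.
  move=> j jp; pose k := Ordinal (allP p39 j jp); exists k => //.
  apply: contraTN isT => aF; move/pred0P/(_ (inl (i, k))): dpF.
  by rewrite /= aF inE eqxx /= jp.
elim: p x {p39 dpF} => [|j p IHp] x pF; first exact: connect0.
apply: connect_trans (IHp _ _) => [|j' j'p]; last first.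
  by apply: pF; rewrite inE j'p orbT.
have [k -> kF] := pF j (mem_head _ _); rewrite /move.
case: eqP => [<-|_]; first exact: (connect_arc kF).
by case: eqP => [<-|_]; [exact: (connect_arc_rev kF) | exact: connect0].
Qed.

Lemma uniq_flatten_nth (T : eqType) (ss : seq (seq T)) k l x :
  uniq (flatten ss) -> x \in nth [::] ss k -> x \in nth [::] ss l -> k = l.
Proof.
have flat (ss' : seq (seq T)) m : x \in nth [::] ss' m -> x \in flatten ss'.
  case: (ltnP m (size ss')) => [lt_m xm|le_m]; last by rewrite nth_default.
  by apply/flattenP; exists (nth [::] ss' m); rewrite ?mem_nth.
elim: ss k l => [|s ss IHss] [|k] [|l] //=;
  rewrite cat_uniq => /and3P[_ /hasPn ds us].
- by move=> xs /flat /ds; rewrite /= xs.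
- by move=> /flat /ds /negP.
- by move=> xk xl; rewrite (IHss k l).
Qed.

Lemma fans_linked i (y : vertex counterexample) (S : seq nat) l :
  {in S, forall x, @linked counterexample (glue i x) y} -> fans_ok S l ->
  {in map fst l, forall x, @linked counterexample (glue i x) y}.
Proof.
elim: l S => [|[x ps] l IHl] S //= linkS /and5P[ps_uniq ps39 /eqP ps3 psS lS].
have linkx : @linked counterexample (glue i x) y.
  apply: (@linked_fan counterexample _ _
    (fun k => path_arcs i (nth [::] ps k))
    (fun k => glue i (walk x (nth [::] ps k)))).
  - move=> k k'; apply: contraNT => /pred0Pn[[[i' j]|q]] /andP[];
      rewrite !inE //.
    move=> /andP[_ jk] /andP[_ jk']; apply/eqP/val_inj.
    exact: uniq_flatten_nth ps_uniq jk jk'.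
  - move=> k F; apply: connect_walk; apply/allP => j jk; apply: (allP ps39).
    by apply/flattenP; exists (nth [::] ps k); rewrite ?mem_nth ?ps3.
  - by move=> k; apply/linkS/(allP psS)/mem_nth; rewrite ps3.
move=> x'; rewrite inE => /predU1P[->//|]; apply: IHl lS _.
by move=> x''; rewrite inE => /predU1P[->//|/linkS].
Qed.

Definition hub (q : 'I_46) : vertex counterexample := inr (Some q).

Lemma hub_linked q r : linked (hub q) (hub r).
Proof.
have [-> | qr] := eqVneq q r; first exact: linked_refl.
have [s] : exists s, s \in ~: [set q; r].
  by apply/set0Pn; rewrite -card_gt0 cardsCs setCK card_ord cards2 qr.
rewrite !inE negb_or => /andP[sq sr].
have [qs rs rq] : [/\ q != s, r != s & r != q] by split; rewrite eq_sym.
pose arc t u (tu : t != u) : arcs counterexample := inr (exist _ (t, u) tu).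
(* Three disjoint classes of arcs: class 0 contains the arc from [q] to [r], class 1 the opposite
   arc, and class 2 the path from [q] to [r] through the third vertex [s]. *)
pose label (p : 'I_46 * 'I_46) : nat :=
  if (p.1 == s) || (p.2 == s) then 2 else p.1 != q.
pose P (k : 'I_3) : {set arcs counterexample} :=
  [set a : arcs counterexample |
     if a is inr p then label (val p) == k else false].
apply: (@linked_fan counterexample _ _ P (fun => hub r)) => [k l|k F dF|_].
- apply: contraNT => /pred0Pn[[?|p]] /andP[]; rewrite !inE //.
  by move=> /eqP pk /eqP pl; apply/eqP/val_inj; rewrite /= -pk -pl.
- have notF a : a \in P k -> a \notin F by move/(disjointFr dF) ->.
  case: k => [[|[|[|//]]] k3] in dF notF *.
  + apply: (connect_arc (notF (arc q r qr) _)).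
    by rewrite inE /label /= (negbTE qs) (negbTE rs) eqxx.
  + apply: (connect_arc_rev (notF (arc r q rq) _)).
    by rewrite inE /label /= (negbTE qs) (negbTE rs) rq.
  + apply: (connect_trans (connect_arc (notF (arc q s qs) _))
                          (connect_arc (notF (arc s r sr) _)));
      by rewrite inE /label /= eqxx ?orbT.
- exact: linked_refl.
Qed.

Lemma glue_v i : glue i 25 = inr None.
Proof. by rewrite /glue insubF. Qed.

Lemma glue_hub i : glue i 26 = hub ord0.
Proof. by rewrite /glue insubF. Qed.

(** The same walk from 25 to 26, taken in each of the three fragments, gives three arc-disjoint
    walks. *)
Lemma v_linked : linked (inr None : vertex counterexample) (hub ord0).
Proof.
pose p := [:: 0; 3; 7; 19; 15; 6; 2].
apply: (@linked_fan counterexample _ _ (path_arcs^~ p) (fun => hub ord0)).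
- move=> k l; apply: contraNT => /pred0Pn[[[i' j]|q]] /andP[]; rewrite !inE //.
  by move=> /andP[/eqP <- _] /andP[].
- move=> k F /(@connect_walk k 25 p F isT).
  by rewrite (_ : walk 25 p = 26) // glue_v glue_hub.
- by move=> _; apply: linked_refl.
Qed.

Lemma counterexample_edge_connected : edge_connected 3 counterexample.
Proof.
split=> [|F F3 x y]; first by rewrite card_counterexample.
suff to_hub z : linked z (hub ord0).
  by apply: linked_trans F F3; [apply: to_hub | apply/linked_sym/to_hub].
case: z => [[i z]|[q|]]; [|exact: hub_linked|exact: v_linked].
have -> : inl (i, z) = glue i z by rewrite /glue valK.
apply: (@fans_linked i _ [:: 25; 26] fans) => [t|//|].
  rewrite !inE => /orP[] /eqP->; rewrite ?glue_v ?glue_hub.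
    exact: v_linked.
  exact: linked_refl.
have : all (mem (map fst fans)) (iota 0 25) by [].
by move/allP; apply; rewrite mem_iota ltn_ord.
Qed.

(** * Parity at the vertex v *)

Lemma glue_eq_v i x : (glue i x == inr None) = (x == 25).
Proof.
rewrite /glue; case: insubP => [y _ <-|_]; first by rewrite [RHS]ltn_eqF /=.
by rewrite (inj_eq inr_inj); case: (x == 25).
Qed.

Lemma crosses_v i (j : 'I_39) :
  @crosses counterexample [set inr None] (inl (i, j)) = (j == ord0).
Proof.
have [s25 _ _] := fragment_bound j; rewrite /crosses !inE !glue_eq_v.
rewrite ltn_eqF //=.
have : all (fun j => (frag_target j == 25) == (j == 0)) (iota 0 39) by [].
by move/allP/(_ j); rewrite mem_iota leq0n ltn_ord => /(_ isT)/eqP.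
Qed.

Theorem proposition3 :
  exists D : multidigraph,
    [/\ is_digraph D,
        #|vertex D| = 122,
        edge_connected 3 D &
        forall E : {set arcs D},
          even_subgraph E -> ~ strongly_connected (contract E)].
Proof.
exists counterexample; split.
- exact: counterexample_is_digraph.
- exact: card_counterexample.
- exact: counterexample_edge_connected.
move=> E evenE scE; have := @even_cut counterexample E [set inr None] evenE.
rewrite big_mkcond big_arcs [X in _ (+) X]big1 => [|p _]; last first.
  by rewrite /crosses /= !inE if_same.
(* Each fragment contributes exactly its arc 0 to the star of v, and the exclusive or of three
   [true] is [true], against evenness. *)
rewrite (eq_bigr (fun => true)) ?big_const_ord // => i _.
rewrite (bigD1 ord0) //= (arc0_in_dijoin i evenE scE) crosses_v eqxx.
rewrite big1 // => j.
by rewrite crosses_v => /negbTE ->; rewrite if_same.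
Qed.
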